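(* Let $A,B\in\mathbb{Z}$ with $4A^3+27B^2\neq 0$, let $E: y^2=x^3+Ax+B$ be the corresponding elliptic curve over $\mathbb{Q}$, and let $P\in E(\mathbb{Q})$ be a point of infinite order. Let $(z_n)_{n\ge 1}$ be a sequence of integers such that for every $n\ge 1$ one has $nP=(x_n/z_n^2,\,y_n/z_n^3)$ with $x_n,y_n,z_n\in\mathbb{Z}$, $z_n\neq 0$ and $\gcd(x_n,y_n,z_n)=1$ (the sign of each $z_n$ can be chosen arbitrarily). Then there is no integer linear recurrence sequence $(u_n)_{n\ge 1}$ for which there exists $N$ with $z_n=u_{n^2}$ for all $n\ge N$.
   Context: An integer sequence $(u_n)_{n\ge 1}$ is a linear recurrence sequence (of order $k\ge 1$) if there are constants $c_1,\dots,c_k$ with $c_k\neq 0$ such that $u_{n+k}=c_1u_{n+k-1}+\cdots+c_ku_n$ for all $n\ge 1$, and $k$ is minimal with this property. The multiple $nP$ is taken in the group $E(\mathbb{Q})$; the coprimality condition determines each $z_n$ up to sign. *)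

(* Defs.v *)
From HB Require Import structures.
From mathcomp Require Import all_boot all_order all_algebra.
From mathcomp Require Import ring.

Set Implicit Arguments.
Unset Strict Implicit.
Unset Printing Implicit Defensive.

Import Order.TTheory GRing.Theory Num.Theory.
Local Open Scope ring_scope.

Section WeierstrassCurve.
Variables (K : fieldType) (a b : K).

(* Points of the projective closure of y^2 = x^3 + a x + b: [None] is the point
   at infinity, [Some (x, y)] an affine point. *)
Definition oncurve (p : option (K * K)) : bool :=
  if p is Some (x, y) then y ^+ 2 == x ^+ 3 + a * x + b else true.

(* Chord-and-tangent addition. For points of the curve, x1 = x2 and y1 <> - y2
   force y1 = y2, hence 2 * y1 <> 0: the tangent slope is never a division
   by zero. *)
Definition addp (p q : option (K * K)) : option (K * K) :=
  match p, q with
  | None, _ => q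
  | _, None => p
  | Some (x1, y1), Some (x2, y2) =>
      if (x1 == x2) && (y1 == - y2) then None else
      let l := if x1 == x2 then (3 * x1 ^+ 2 + a) / (2 * y1)
               else (y2 - y1) / (x2 - x1) in
      let x3 := l ^+ 2 - x1 - x2 in
      Some (x3, l * (x1 - x3) - y1)
  end.

Lemma addp_oncurve p q : oncurve p -> oncurve q -> oncurve (addp p q).
Proof.
case: p q => [[x1 y1]|] [[x2 y2]|] //= /eqP h1 /eqP h2.
case: (eqVneq x1 x2) => [e|ne] /=.
  subst x2; case: (eqVneq y1 (- y2)) => [//|ny] /=; apply/eqP.
  have e : y1 = y2.
    have : (y1 - y2) * (y1 + y2) = 0 by rewrite -subr_sqr h1 h2 subrr.
    by move/eqP; rewrite mulf_eq0 subr_eq0 addr_eq0 (negPf ny) orbF => /eqP.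
  subst y2; clear h2.
  have n0 : 2 * y1 != 0.
    by rewrite mulr_natl mulr2n addr_eq0.
  set l := _ / _.
  have hl : l * (2 * y1) = 3 * x1 ^+ 2 + a by rewrite /l divfK.
  apply/eqP; rewrite -subr_eq0; apply/eqP.
  have -> : b = y1 ^+ 2 - x1 ^+ 3 - a * x1 by rewrite h1; ring.
  have -> : a = l * (2 * y1) - 3 * x1 ^+ 2 by rewrite hl; ring.
  ring.
apply/eqP.
have n0 : x2 - x1 != 0 by rewrite subr_eq0 eq_sym.
set l := _ / _.
have hl : y2 = y1 + l * (x2 - x1) by rewrite /l divfK //; ring.
apply: (mulfI n0); apply/eqP; rewrite -subr_eq0; apply/eqP.
have hb : b = y1 ^+ 2 - x1 ^+ 3 - a * x1 by rewrite h1; ring.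
have ha : (x2 - x1) * a = y2 ^+ 2 - y1 ^+ 2 - (x2 ^+ 3 - x1 ^+ 3).
  by rewrite h1 h2; ring.
move: ha; rewrite hl hb => ha.
set t := l ^+ 2 - x1 - x2.
transitivity ((x2 - x1) * ((l * (x1 - t) - y1) ^+ 2 - t ^+ 3 - y1 ^+ 2 + x1 ^+ 3)
  - ((x2 - x1) * a) * (t - x1)); first by ring.
by rewrite ha /t; ring.
Qed.

Definition ec : Type := {p : option (K * K) | oncurve p}.

Definition ec0 : ec := exist _ None isT.

Definition ec_add (P Q : ec) : ec :=
  exist _ (addp (val P) (val Q)) (addp_oncurve (valP P) (valP Q)).

Definition ec_mul (n : nat) (P : ec) : ec := iter n (ec_add P) ec0.

Definition infinite_order (P : ec) : Prop :=
  forall n : nat, (0 < n)%N -> ec_mul n P <> ec0.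

End WeierstrassCurve.

(* Sequences (u_n)_{n >= 1} are functions on nat whose value at 0 is never used;
   the coefficient c_(i+1) is [c i], and the constants lie in the field K. *)
Definition lin_rec (K : numFieldType) (u : nat -> int) (k : nat) : Prop :=
  exists c : nat -> K, c k.-1 != 0 /\
    forall n : nat, (0 < n)%N ->
      (u (n + k)%N)%:~R = \sum_(i < k) c i * (u (n + k - i.+1)%N)%:~R.

Definition lin_rec_order (K : numFieldType) (u : nat -> int) (k : nat) : Prop :=
  [/\ (0 < k)%N, lin_rec K u k &
      forall j : nat, (0 < j)%N -> lin_rec K u j -> (k <= j)%N].

Definition lin_rec_seq (K : numFieldType) (u : nat -> int) : Prop :=
  exists k : nat, lin_rec_order K u k.

(* Main.v *)
(* The two sides behave differently 2-adically near n = 0.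
   Some z_r is even: otherwise two multiples nP, mP with the same coordinates
   modulo a large power of 2 have a difference (n - m)P with even denominator,
   unless y_n is highly divisible by 2, in which case 2nP has even denominator
   because the discriminant is nonzero. Once z_n is even, the duplication formula
   gives v_2(z_(2n)) = v_2(z_n) + 1, so v_2(z_(r 2^s)) grows like s.
   On the other hand u satisfies a relation X^m (X^T - 1) = 2 b(X) in the shift
   operator X, with b integral, and by repeated squaring it is eventually periodic
   modulo 2^(j+1) with period T 2^j. Write T = 2^e T' with T' odd. If T' divides
   4^f - 1, then r^2 4^s and r^2 4^(s+f) are congruent modulo T 2^j with
   j about 2s, so z_(r 2^s) and z_(r 2^(s+f)) are congruent modulo 2^(j+1).
   Taking f large forces v_2(z_(r 2^s)) to be about 2s, a contradiction. *)

Require Import Defs.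
From HB Require Import structures.
From mathcomp Require Import all_boot all_order all_algebra.
From mathcomp Require Import cyclic ring zify.

Set Implicit Arguments.
Unset Strict Implicit.
Unset Printing Implicit Defensive.

Import Order.TTheory GRing.Theory Num.Theory.
Local Open Scope ring_scope.

(** * Associativity of chord-and-tangent addition *)

Section GroupLaw.
Variables (K : fieldType) (a b : K).
Hypothesis char2 : 2 != 0 :> K.
Hypothesis disc : 4 * a ^+ 3 + 27 * b ^+ 2 != 0.

Implicit Types (P Q R : ec a b).

Definition ec_opp_val (p : option (K * K)) : option (K * K) :=
  if p is Some (x, y) then Some (x, - y) else None.

Lemma ec_opp_oncurve P : oncurve a b (ec_opp_val (val P)).
Proof. by case: P => [[[x y]|]] //=; rewrite sqrrN. Qed.

Definition ec_opp P : ec a b := exist _ (ec_opp_val (val P)) (ec_opp_oncurve P).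

Local Notation O := (ec0 a b).
Local Notation "P +' Q" := (ec_add P Q) (at level 50, left associativity).
Local Notation "-' P" := (ec_opp P) (at level 35, right associativity).

Lemma ec_ext P Q : val P = val Q -> P = Q.
Proof. exact: val_inj. Qed.

Lemma ec_add0 P : O +' P = P.
Proof. exact: ec_ext. Qed.

Lemma oncurve_same_x (x y y' : K) :
  oncurve a b (Some (x, y)) -> oncurve a b (Some (x, y')) -> y = y' \/ y = - y'.
Proof.
move=> /= /eqP e /eqP e'; have /eqP : (y - y') * (y + y') = 0.
  by rewrite -subr_sqr e e' subrr.
by rewrite mulf_eq0 subr_eq0 addr_eq0 => /orP[] /eqP; [left|right].
Qed.

Lemma ec_addC P Q : P +' Q = Q +' P.
Proof.
apply: ec_ext; case: P Q => [[[x1 y1]|] /= h1] [[[x2 y2]|] /= h2] //=.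
rewrite (eq_sym x2 x1); case: (eqVneq x1 x2) => [e|ne] /=.
  subst x2; rewrite -eqr_oppLR eq_sym; case: eqP => // /eqP n.
  have [e|e] := oncurve_same_x h1 h2; first by rewrite e.
  by rewrite e opprK eqxx in n.
have n1 : x2 - x1 != 0 by rewrite subr_eq0 eq_sym.
have n2 : x1 - x2 != 0 by rewrite subr_eq0.
by congr (Some (_, _)); field; rewrite n1 n2.
Qed.

Lemma ec_addr0 P : P +' O = P.
Proof. by rewrite ec_addC ec_add0. Qed.

Lemma ec_oppK P : -' -' P = P.
Proof. by apply: ec_ext; case: P => [[[x y]|] h] //=; rewrite opprK. Qed.

Lemma ec_addN P : P +' -' P = O.
Proof. by apply: ec_ext; case: P => [[[x y]|] h] //=; rewrite opprK !eqxx. Qed.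

Lemma ec_add_eq0 P Q : P +' Q = O -> Q = -' P.
Proof.
case: P Q => [[[x1 y1]|] h1] [[[x2 y2]|] h2] /(congr1 val) //=; last first.
  by move=> _; apply: ec_ext.
by case: ifP => // /andP[/eqP e1 /eqP e2] _; apply: ec_ext; rewrite /= e1 e2 opprK.
Qed.

Lemma ec_oppD P Q : -' (P +' Q) = -' P +' -' Q.
Proof.
apply: ec_ext; case: P Q => [[[x1 y1]|] h1] [[[x2 y2]|] h2] //=.
rewrite eqr_opp; case: ifP => //= _; case: eqP => [e|/eqP ne].
  by rewrite mulrN invrN mulrN sqrrN; congr (Some (_, _)); ring.
have -> : (- y2 - - y1) / (x2 - x1) = - ((y2 - y1) / (x2 - x1)).
  by rewrite -mulNr; congr (_ / _); ring.
by rewrite sqrrN; congr (Some (_, _)); ring.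
Qed.

(* The line of slope [l] through both points meets the cubic again above [x4];
   comparing coefficients of [X] in the cubic shifted to [x2] gives the last
   equation, which is uniform in the chord and tangent cases. *)
Lemma addp_line (x1 y1 x2 y2 : K) :
  oncurve a b (Some (x1, y1)) -> oncurve a b (Some (x2, y2)) ->
  ~~ ((x1 == x2) && (y1 == - y2)) ->
  exists l, let x4 := l ^+ 2 - x1 - x2 in
  [/\ addp a (Some (x1, y1)) (Some (x2, y2)) = Some (x4, - (y2 + l * (x4 - x2))),
      y1 = y2 + l * (x1 - x2) &
      3 * x2 ^+ 2 + a = 2 * l * y2 + (x1 - x2) * (x4 - x2)].
Proof.
move=> h1 h2 nop; rewrite /addp (negPf nop).
case: (eqVneq x1 x2) nop => [e|ne] /= nop.
  subst x2; have [e|e] := oncurve_same_x h1 h2; last by rewrite e eqxx in nop.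
  subst y2; have n : 2 * y1 != 0 by rewrite mulr_natl mulr2n addr_eq0.
  exists ((3 * x1 ^+ 2 + a) / (2 * y1)); set l := _ / _.
  have hl : l * (2 * y1) = 3 * x1 ^+ 2 + a by rewrite /l divfK.
  split; [by congr (Some (_, _)); ring | ring |].
  by rewrite -hl; ring.
have n : x2 - x1 != 0 by rewrite subr_eq0 eq_sym.
exists ((y2 - y1) / (x2 - x1)); set l := _ / _.
have hl : y1 = y2 + l * (x1 - x2) by rewrite /l; field.
split=> //; first by rewrite hl; congr (Some (_, _)); ring.
apply: (mulIf n); move: h1 h2 => /= /eqP h1 /eqP h2.
have : y2 ^+ 2 - y1 ^+ 2 = x2 ^+ 3 - x1 ^+ 3 + a * (x2 - x1).
  by rewrite h1 h2; ring.
rewrite hl => E; transitivity (3 * x2 ^+ 2 * (x2 - x1) + a * (x2 - x1)); first ring.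
rewrite -[a * _](addKr (x2 ^+ 3 - x1 ^+ 3)) -E; ring.
Qed.

Lemma addp_chord (x1 y1 x2 y2 l : K) :
  x1 != x2 -> l * (x2 - x1) = y2 - y1 ->
  addp a (Some (x1, y1)) (Some (x2, y2)) =
  Some (l ^+ 2 - x1 - x2, l * (x1 - (l ^+ 2 - x1 - x2)) - y1).
Proof.
move=> ne hl; have n : x2 - x1 != 0 by rewrite subr_eq0 eq_sym.
by rewrite /addp (negPf ne) /= -hl mulfK.
Qed.

Lemma oncurve_nonsingular (x y : K) :
  oncurve a b (Some (x, y)) -> y = 0 -> 3 * x ^+ 2 + a != 0.
Proof.
move=> /= /eqP h y0; apply: contra disc => /eqP e.
rewrite y0 expr0n /= in h; apply/eqP.
(* A Bezout identity: the discriminant lies in the ideal generated by the cubic and its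
   derivative. *)
transitivity ((27 * b - 18 * a * x) * (x ^+ 3 + a * x + b) +
   (6 * a * x ^+ 2 - 9 * b * x + 4 * a ^+ 2) * (3 * x ^+ 2 + a)); first by ring.
by rewrite -h e !mulr0 addr0.
Qed.

(** Cancellation comes before associativity: the line through P + Q and -Q is the mirror image of
    the line through P and Q, so it has slope [- l] and meets the curve again above P. *)
Lemma ec_addK P Q : (P +' Q) +' -' Q = P.
Proof.
case: (Q =P -' P) => [->|nQ]; first by rewrite ec_addN ec_oppK ec_add0.
case: P Q nQ => [[[x1 y1]|] h1] [[[x2 y2]|] h2] nQ; last 3 first.
- by rewrite [_ +' exist _ None h2]ec_addC; apply: ec_ext.
- by apply: ec_ext => /=; rewrite opprK !eqxx.
- exact: ec_ext.
have nop : ~~ ((x1 == x2) && (y1 == - y2)).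
  apply/negP => /andP[/eqP e1 /eqP e2]; apply: nQ; apply: ec_ext => /=.
  by rewrite e1 e2 opprK.
have [l [E ey ea]] := addp_line h1 h2 nop.
apply: ec_ext.
change (addp a (addp a (Some (x1, y1)) (Some (x2, y2))) (Some (x2, - y2)) =
        Some (x1, y1)).
rewrite E; set x4 := l ^+ 2 - _ - _ in ea *.
case: (eqVneq x4 x2) => [e|ne]; last first.
  rewrite (@addp_chord _ _ _ _ (- l)) //; last by ring.
  by rewrite /= [in RHS]ey /x4; congr (Some (_, _)); ring.
(* Here P + Q = -Q and the sum is a doubling; [ea] identifies the tangent slope, and nonsingularity
   excludes [y2 = 0]. *)
rewrite /addp e eqxx opprK; move: ea; rewrite e subrr !mulr0 !addr0 => ea.
case: (eqVneq y2 0) => [y0|ny].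
  by have := oncurve_nonsingular h2 y0; rewrite ea y0 mulr0 eqxx.
have n : 2 * y2 != 0 by rewrite mulf_neq0.
have /negPf -> : - y2 != y2.
  by apply: contra n => /eqP e2; rewrite mulr_natl mulr2n -{1}e2 addNr.
rewrite /= ea.
have -> : 2 * l * y2 / (2 * - y2) = - l.
  by field; rewrite oppr_eq0 ny char2.
have ex : x1 = l ^+ 2 - x2 - x2 by rewrite -{1}e /x4; ring.
by rewrite ey ex; congr (Some (_, _)); ring.
Qed.

Lemma ec_addNK P Q : (P +' -' Q) +' Q = P.
Proof. by rewrite -{2}[Q]ec_oppK ec_addK. Qed.

Lemma ec_addIr R P Q : P +' R = Q +' R -> P = Q.
Proof. by move=> e; rewrite -(ec_addK P R) e ec_addK. Qed.

Lemma ec_addIl R P Q : R +' P = R +' Q -> P = Q.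
Proof. by rewrite ![R +' _]ec_addC; apply: ec_addIr. Qed.

Lemma ec_neq_x (x1 y1 x2 y2 : K) h1 h2 :
  exist _ (Some (x1, y1)) h1 <> exist _ (Some (x2, y2)) h2 :> ec a b ->
  exist _ (Some (x1, y1)) h1 <> -' exist _ (Some (x2, y2)) h2 -> x1 != x2.
Proof.
move=> n1 n2; apply/eqP => e; subst x2.
by have [e|e] := oncurve_same_x h1 h2; [case: n1|case: n2]; apply: ec_ext; rewrite /= e.
Qed.


(* Lines of slopes [l] through A, B and [m] through B, C, in coordinates
   centred at the abscissa of B: the slope of the line through A + B and C is
   [(l * m - X3 - X4 - 3 * x2) / (l - m)], and adding [l - m] to it gives the
   slope of the line through A and B + C. *)
Lemma ec_addA_chords (x1 y1 x2 y2 x3 y3 : K) h1 h2 h3 :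
  let P := exist _ (Some (x1, y1)) h1 : ec a b in
  let Q := exist _ (Some (x2, y2)) h2 : ec a b in
  let R := exist _ (Some (x3, y3)) h3 : ec a b in
  P +' Q <> O -> Q +' R <> O -> P +' Q +' R <> O -> P +' (Q +' R) <> O ->
  P +' Q <> R -> P <> Q +' R -> (P +' Q) +' R = P +' (Q +' R).
Proof.
move=> P Q R nPQ nQR nPQR nPQR' nPQeR nPeQR.
have nop : ~~ ((x1 == x2) && (y1 == - y2)).
  by apply/negP => nn; apply: nPQ; apply: ec_ext => /=; rewrite nn.
have nop' : ~~ ((x3 == x2) && (y3 == - y2)).
  apply/negP => nn; apply: nQR; rewrite ec_addC; apply: ec_ext => /=; by rewrite nn.
have [l [E ey ea]] := addp_line h1 h2 nop.
have [m [F fy fa]] := addp_line h3 h2 nop'.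
set x4 := l ^+ 2 - _ - _ in E ea; set x5 := m ^+ 2 - _ - _ in F fa.
set y4 := - (_) in E; set y5 := - (_) in F.
have vPQ : val (P +' Q) = Some (x4, y4) by exact: E.
have vQR : val (Q +' R) = Some (x5, y5) by rewrite ec_addC; exact: F.
have n34 : x4 != x3.
  move: vPQ nPQR nPQeR; case: (P +' Q) => [[[x y]|] h] //= [ex ey'] n1 n2.
  subst x y; apply: (@ec_neq_x _ _ _ _ h h3) => // e; apply: n1.
  by rewrite e ec_addC ec_addN.
have n15 : x1 != x5.
  move: vQR nPQR' nPeQR; case: (Q +' R) => [[[x y]|] h] //= [ex ey'] n1 n2.
  subst x y; apply: (@ec_neq_x _ _ _ _ h1 h) => // e; apply: n1.
  by rewrite /P e ec_addC ec_addN.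
(* Equal slopes put A, B, C on one line; since [x3] differs from [x4], this forces A = C, and
   commutativity suffices. *)
case: (eqVneq l m) => [elm|nlm].
  suff ePR : P = R by rewrite ePR [LHS]ec_addC [R +' Q]ec_addC.
  have ex : x3 = x1.
    have /eqP : (x3 - x1) * (x3 - x4) = 0.
      have e1 : (x1 - x2) * (x4 - x2) = (x3 - x2) * (x5 - x2).
        by apply: (addrI (2 * l * y2)); rewrite -ea {}fa elm.
      have e2 : x5 = x1 + x4 - x3 by rewrite /x5 /x4 elm; ring.
      by move: e1; rewrite e2 => /eqP; rewrite -subr_eq0 => /eqP <-; ring.
    by rewrite mulf_eq0 !subr_eq0 [x3 == x4]eq_sym (negPf n34) orbF => /eqP.
  by apply: ec_ext => /=; rewrite ey fy elm ex.
have d0 : l - m != 0 by rewrite subr_eq0.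
(* The difference of [ea] and [fa], in which the curve coefficient [a] cancels. *)
have y2E : 2 * y2 * (l - m) = (x3 - x2) * (x5 - x2) - (x1 - x2) * (x4 - x2).
  transitivity (2 * l * y2 - 2 * m * y2); first ring.
  have -> : 2 * l * y2 = 3 * x2 ^+ 2 + a - (x1 - x2) * (x4 - x2) by rewrite ea; ring.
  by rewrite fa; ring.
have [s sE] : exists s, s * (l - m) = l * m - x3 - x4 - x2.
  by exists ((l * m - x3 - x4 - x2) / (l - m)); rewrite divfK.
have hs : s * (x3 - x4) = y3 - y4.
  apply: (mulIf d0); rewrite mulrAC sE fy /y4; apply/eqP; rewrite -subr_eq0; apply/eqP.
  transitivity ((l * m - x3 - x4 - x2) * (x3 - x4) -
    (2 * y2 * (l - m) + (m * (x3 - x2) + l * (x4 - x2)) * (l - m))); first ring.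
  by rewrite y2E /x5 /x4; ring.
have ht : (s + l - m) * (x5 - x1) = y5 - y1.
  apply: (mulIf d0); rewrite ey /y5; apply/eqP; rewrite -subr_eq0; apply/eqP.
  transitivity ((s * (l - m) + (l - m) ^+ 2) * (x5 - x1) + (2 * y2 * (l - m) +
    (m * (x5 - x2) + l * (x1 - x2)) * (l - m))); first ring.
  by rewrite sE y2E /x5 /x4; ring.
apply: ec_ext.
change (addp a (val (P +' Q)) (Some (x3, y3)) = addp a (Some (x1, y1)) (val (Q +' R))).
rewrite vPQ vQR (addp_chord n34 hs) (addp_chord n15 ht).
have -> : (s + l - m) ^+ 2 - x1 - x5 = s ^+ 2 - x4 - x3.
  have -> : (s + l - m) ^+ 2 = s ^+ 2 + 2 * (s * (l - m)) + (l - m) ^+ 2 by ring.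
  by rewrite sE /x5 /x4; ring.
congr (Some (_, _)); apply: (mulIf d0); rewrite ey /y4; apply/eqP; rewrite -subr_eq0; apply/eqP.
transitivity ((s * (l - m)) * (x4 - x1) - (l - m) ^+ 2 * x1 + (s * (l - m)) ^+ 2
  - (l - m) ^+ 2 * (x4 + x3) + 2 * y2 * (l - m) + (l - m) * l * (x4 + x1 - 2 * x2)).
  ring.
by rewrite sE y2E /x5 /x4; ring.
Qed.

(** The hypotheses keep both outer sums from being doublings. If an intermediate or final sum is the
    point at infinity, cancellation and commutativity suffice. *)
Lemma ec_addA_generic P Q R :
  P +' Q <> R -> P <> Q +' R -> (P +' Q) +' R = P +' (Q +' R).
Proof.
move=> n1 n2.
have [->|nP] := eqVneq P O; first by rewrite !ec_add0.
have [->|nQ] := eqVneq Q O; first by rewrite ec_addr0 ec_add0.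
have [->|nR] := eqVneq R O; first by rewrite !ec_addr0.
have [/ec_add_eq0 ->|/eqP nPQ] := eqVneq (P +' Q) O.
  by rewrite ec_addN ec_add0 [_ +' R]ec_addC [RHS]ec_addC -{2}[P]ec_oppK ec_addK.
have [/ec_add_eq0 ->|/eqP nQR] := eqVneq (Q +' R) O.
  by rewrite ec_addN ec_addr0 ec_addK.
have [/ec_add_eq0 e|/eqP nPQR] := eqVneq (P +' Q +' R) O.
  rewrite e ec_addN [P +' Q]ec_addC ec_oppD [Q +' _]ec_addC [-' Q +' _]ec_addC.
  by rewrite ec_addNK ec_addN.
have [e|/eqP nPQR'] := eqVneq (P +' (Q +' R)) O.
  rewrite e; move: e; rewrite ec_addC => /ec_add_eq0 ->.
  rewrite ec_oppD [_ +' Q]ec_addC [-' Q +' _]ec_addC [Q +' _]ec_addC ec_addNK.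
  by rewrite ec_addC ec_addN.
move: P Q R nP nQ nR n1 n2 nPQ nQR nPQR nPQR'.
have ec_None h : exist _ None h = O by apply: ec_ext.
move=> [[[x1 y1]|] h1]; last by rewrite ec_None eqxx.
move=> [[[x2 y2]|] h2]; last by rewrite ec_None eqxx.
move=> [[[x3 y3]|] h3]; last by rewrite ec_None eqxx.
by move=> *; apply: ec_addA_chords.
Qed.

(* The doubling (P + Q) + (P + Q) is reached through the generic triples
   (P + Q, P + Q, -Q) and (P, Q + (P + Q), -Q). *)
Lemma ec_addA_double P Q : (P +' Q) +' (P +' Q) = P +' (Q +' (P +' Q)).
Proof.
have dec X Y : X = Y \/ X <> Y :> ec a b by case: (eqVneq X Y) => [|/eqP]; auto.
have [->|nQ] := dec Q O; first by rewrite !ec_addr0 ec_add0.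
set D := P +' Q.
have eD : D +' -' Q = P by rewrite ec_addK.
have fixQ X : X +' -' Q = X -> False.
  by rewrite -{2}[X]ec_addr0 => /ec_addIl e; apply: nQ; rewrite -[Q]ec_oppK e; apply: ec_ext.
(* The exceptional cases of the two generic triples, where the sum of the first two points is
   already -Q, are computed directly. *)
have [e|n1] := dec (D +' D) (-' Q).
  have eQ : Q = -' D +' -' D by rewrite -ec_oppD e ec_oppK.
  have eQD : Q +' D = -' D by rewrite {1}eQ ec_addNK.
  by rewrite e eQD /D ec_oppD [-' P +' _]ec_addC [RHS]ec_addC ec_addNK.
have [e|n2] := dec (P +' (Q +' D)) (-' Q).
  have e2 : Q +' D = -' D.
    rewrite -(ec_addK (Q +' D) P) [Q +' D +' P]ec_addC e /D ec_oppD; exact: ec_addC.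
  rewrite e; have : Q = -' D +' -' D by rewrite -{1}e2 ec_addK.
  by rewrite -ec_oppD => ->; rewrite ec_oppK.
apply: (@ec_addIr (-' Q)).
rewrite [LHS]ec_addA_generic //; last by move=> e; apply: (fixQ D).
rewrite [RHS]ec_addA_generic //.
  by rewrite eD [Q +' D]ec_addC ec_addK ec_addC.
rewrite [Q +' D]ec_addC ec_addK => e.
by apply: (fixQ D); rewrite eD.
Qed.

Lemma ec_addA P Q R : (P +' Q) +' R = P +' (Q +' R).
Proof.
case: (eqVneq (P +' Q) R) => [<-|/eqP n1]; first exact: ec_addA_double.
case: (eqVneq P (Q +' R)) => [->|/eqP n2]; last exact: ec_addA_generic.
rewrite [Q +' R]ec_addC [_ +' R]ec_addC [R +' Q +' Q]ec_addC.
by rewrite [RHS]ec_addA_double [Q +' _]ec_addC.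
Qed.

Lemma ec_mulS n P : ec_mul n.+1 P = P +' ec_mul n P.
Proof. by []. Qed.

Lemma ec_mulD m n P : ec_mul (m + n) P = ec_mul m P +' ec_mul n P.
Proof.
elim: m => [|m IH]; first by rewrite ec_add0.
by rewrite addSn !ec_mulS IH ec_addA.
Qed.

End GroupLaw.

(** * Denominators modulo powers of 2 *)

(** Stated for a relation, so that no choice of the coordinates of nP is needed. *)
Lemma pigeonhole (T : finType) (p : nat -> T -> Prop) (k : nat) :
  (forall n, (k <= n)%N -> exists t, p n t) ->
  exists m n t, [/\ (k <= m)%N, (m < n)%N, p m t & p n t].
Proof.
move=> h.
have /fin_all_exists[f hf] : forall i : 'I_#|T|.+1, exists t, p (k + i)%N t.
  by move=> i; apply: h; rewrite leq_addr.
have /injectivePn[i [j nij eij]] : ~~ injectiveb f.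
  by apply/injectiveP => /leq_card; rewrite card_ord ltnn.
wlog lij : i j nij eij / (i < j)%N.
  move=> w; case: (ltngtP i j) => [l|l|/val_inj e]; first exact: w l.
    by apply: w l; rewrite // eq_sym.
  by rewrite e eqxx in nij.
exists (k + i)%N, (k + j)%N, (f i); rewrite leq_addr ltn_add2l lij.
by split=> //; rewrite eij.
Qed.

Definition residue (M : nat) (x : int) : 'I_M.+1 := inord `|(x %% M.+1)%Z|%N.

Lemma residue_dvd (M : nat) (x y : int) :
  residue M x = residue M y -> (M.+1%:Z %| x - y)%Z.
Proof.
have lt t : (`|(t %% M.+1)%Z| < M.+1)%N.
  by rewrite -ltz_nat gez0_abs ?modz_ge0 // ltz_pmod.
move=> /(congr1 val); rewrite /= !inordK // => e.
by rewrite -eqz_mod_dvd -(gez0_abs (modz_ge0 x _)) // e gez0_abs ?modz_ge0.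
Qed.

Section Denominators.
Variables (A B : int).
Hypothesis disc : 4 * A ^+ 3 + 27 * B ^+ 2 != 0.
Local Notation E := (ec (A%:~R : rat) (B%:~R : rat)).

Definition reduced_form (Q : E) (x y z : int) : Prop :=
  [/\ z != 0, gcdz (gcdz x y) z = 1 &
      val Q = Some ((x%:~R : rat) / z%:~R ^+ 2, (y%:~R : rat) / z%:~R ^+ 3)].

Lemma char2_rat : 2 != 0 :> rat. Proof. by []. Qed.

Lemma disc_rat : 4 * (A%:~R : rat) ^+ 3 + 27 * (B%:~R : rat) ^+ 2 != 0.
Proof.
have -> : 4 * (A%:~R : rat) ^+ 3 + 27 * (B%:~R : rat) ^+ 2 =
          (4 * A ^+ 3 + 27 * B ^+ 2)%:~R.
  by rewrite !(rmorphD, rmorphXn, rmorphM).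
by rewrite intr_eq0.
Qed.

Local Notation "P +' Q" := (ec_add P Q) (at level 50, left associativity).

Lemma reduced_form_curve (Q : E) x y z :
  reduced_form Q x y z -> y ^+ 2 = x ^+ 3 + A * x * z ^+ 4 + B * z ^+ 6.
Proof.
case=> nz _; case: Q => q /= hq eq; move: hq; rewrite eq /= => /eqP h.
have nz' : z%:~R != 0 :> rat by rewrite intr_eq0.
apply: (@intr_inj rat); rewrite !(rmorphD, rmorphXn, rmorphM) /=.
move: h; set X : rat := x%:~R; set Y : rat := y%:~R; set Z : rat := z%:~R in nz' *.
move=> h.
have -> : Y ^+ 2 = Z ^+ 6 * (Y / Z ^+ 3) ^+ 2 by field.
by rewrite h; field.
Qed.

(** The duplication formula x(2Q) + 2 x(Q) = slope^2, cleared of denominators. *)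
Lemma reduced_form_double (Q : E) x y z x' y' z' :
  Q +' Q <> ec0 _ _ -> reduced_form Q x y z -> reduced_form (Q +' Q) x' y' z' ->
  (x' * z ^+ 2 + 2 * x * z' ^+ 2) * (2 * y) ^+ 2 =
  z' ^+ 2 * (3 * x ^+ 2 + A * z ^+ 4) ^+ 2.
Proof.
move=> n0 [nz _ hQ] [nz' _ h2Q].
have nZ : z%:~R != 0 :> rat by rewrite intr_eq0.
have nZ' : z'%:~R != 0 :> rat by rewrite intr_eq0.
have nY : y%:~R != 0 :> rat.
  apply/eqP => y0; apply: n0; apply: val_inj.
  by rewrite /= hQ y0 mul0r /= oppr0 !eqxx.
apply: (@intr_inj rat); rewrite !(rmorphD, rmorphXn, rmorphM).
move: h2Q; rewrite /= hQ /= eqxx /=.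
set X : rat := x%:~R; set Y : rat := y%:~R in nY *; set Z : rat := z%:~R in nZ *.
set X' : rat := x'%:~R; set Y' : rat := y'%:~R; set Z' : rat := z'%:~R in nZ' *.
case: ifP => // _ [/esym h _].
have -> : X' = Z' ^+ 2 * (X' / Z' ^+ 2) by field.
by rewrite h; field; rewrite nZ nY.
Qed.

(** The chord formula for the abscissa of R = (R + Q) + (-Q), cleared of denominators. The two
    hypotheses on R make the abscissas of R + Q and Q distinct. *)
Lemma reduced_form_diff (Q R : E) x y z x1 y1 z1 x2 y2 z2 :
  R <> ec0 _ _ -> R +' Q +' Q <> ec0 _ _ ->
  reduced_form Q x1 y1 z1 -> reduced_form (R +' Q) x2 y2 z2 ->
  reduced_form R x y z ->
  (x * z2 ^+ 2 * z1 ^+ 2 + (x2 * z1 ^+ 2 + x1 * z2 ^+ 2) * z ^+ 2) *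
    (x2 * z1 ^+ 2 - x1 * z2 ^+ 2) ^+ 2 =
  z ^+ 2 * (y2 * z1 ^+ 3 + y1 * z2 ^+ 3) ^+ 2.
Proof.
move=> n1 n2 [nz1 _ hQ] [nz2 _ hRQ] [nz _ hR].
have nZ : z%:~R != 0 :> rat by rewrite intr_eq0.
have nZ1 : z1%:~R != 0 :> rat by rewrite intr_eq0.
have nZ2 : z2%:~R != 0 :> rat by rewrite intr_eq0.
have eR : R = (R +' Q) +' ec_opp Q by rewrite (ec_addK char2_rat disc_rat).
have nx : x2%:~R / z2%:~R ^+ 2 != x1%:~R / z1%:~R ^+ 2 :> rat.
  move: n1 n2 hQ hRQ eR.
  case: (R +' Q) => [[[u v]|] h] //; case: Q => [[[u' v']|] h'] //.
  move=> n1 n2 [e1 e2] [e3 e4] eR; rewrite -e1 -e3; apply: (@ec_neq_x _ _ _ _ _ _ _ h h').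
    by move=> e; apply: n1; rewrite eR e ec_addN.
  by move=> e; apply: n2; rewrite e ec_addC ec_addN.
apply: (@intr_inj rat); rewrite !(rmorphD, rmorphN, rmorphXn, rmorphM) /=.
move: eR => /(congr1 val).
change (val (R +' Q +' ec_opp Q)) with
  (addp A%:~R (val (R +' Q)) (ec_opp_val (val Q))).
rewrite hR hRQ hQ /= (negPf nx) /=.
move: nZ nZ1 nZ2 nx.
set X : rat := x%:~R; set Y : rat := y%:~R; set Z : rat := z%:~R.
set X1 : rat := x1%:~R; set Y1 : rat := y1%:~R; set Z1 : rat := z1%:~R.
set X2 : rat := x2%:~R; set Y2 : rat := y2%:~R; set Z2 : rat := z2%:~R.
move=> nZ nZ1 nZ2 nx [h _].
have nU : X1 * Z2 ^+ 2 - X2 * Z1 ^+ 2 != 0.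
  apply: contra nx; rewrite subr_eq0 => /eqP e; apply/eqP.
  have -> : X1 = X2 * Z1 ^+ 2 / Z2 ^+ 2 by rewrite -e; field.
  by field; rewrite nZ1.
have -> : X = Z ^+ 2 * (X / Z ^+ 2) by field.
by rewrite h; field; rewrite nZ1 nZ2 mulNr nU.
Qed.

(** * Parity and 2-adic valuation of coordinates *)

Lemma coprime_exp2 (N : nat) (x : int) : ~~ (2 %| x)%Z -> coprimez (2 ^+ N) x.
Proof.
move=> h; apply: coprimezXl.
by rewrite coprimezE coprime2n; move: h; rewrite dvdzE dvdn2 negbK.
Qed.

Lemma dvdz2M (x y : int) : (2 %| x * y)%Z = (2 %| x)%Z || (2 %| y)%Z.
Proof. by rewrite !dvdzE abszM Euclid_dvdM. Qed.

Lemma dvdz2X (x : int) n : (2 %| x ^+ n)%Z = (2 %| x)%Z && (0 < n)%N.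
Proof. by rewrite !dvdzE abszX Euclid_dvdX. Qed.

(** For even z the curve equation gives y^2 = x^3 modulo 2, so x and y have the same parity;
    coprimality makes it odd. *)
Lemma reduced_form_odd (Q : E) x y z :
  reduced_form Q x y z -> (2 %| z)%Z -> ~~ (2 %| x)%Z && ~~ (2 %| y)%Z.
Proof.
move=> h dz; have c := reduced_form_curve h; case: h => _ g _.
have e : (2 %| y)%Z = (2 %| x)%Z.
  have -> : (2 %| y)%Z = (2 %| y ^+ 2)%Z by rewrite dvdz2X andbT.
  have -> : (2 %| x)%Z = (2 %| x ^+ 3)%Z by rewrite dvdz2X andbT.
  rewrite c -addrA rpredDr //; apply: rpredD; apply: dvdz_mull; by rewrite dvdz2X dz.
rewrite e andbb; apply/negP => dx.
have : (2 %| gcdz (gcdz x y) z)%Z by rewrite !dvdz_gcd e dx dz.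
by rewrite g.
Qed.

Lemma logn2_odd (x : int) : ~~ (2 %| x)%Z -> logn 2 `|x| = 0%N.
Proof.
by rewrite dvdzE dvdn2 negbK => h; apply: logn_coprime; rewrite coprime2n.
Qed.

(** The duplication formula rearranges to z'^2 W = 4 y^2 z^2 x' with W and y odd. Hence z' is even,
    so x' is odd, and the valuations can be compared. *)
Lemma reduced_form_logn_double (Q : E) x y z x' y' z' :
  Q +' Q <> ec0 _ _ -> reduced_form Q x y z -> reduced_form (Q +' Q) x' y' z' ->
  (2 %| z)%Z -> logn 2 `|z'| = (logn 2 `|z|).+1.
Proof.
move=> n0 h h' dz; have r := reduced_form_double n0 h h'.
have /andP[ox oy] := reduced_form_odd h dz.
have nz : z != 0 by case: h.
have nz' : z' != 0 by case: h'.
have absz_gt0' (t : int) : t != 0 -> (0 < `|t|)%N by rewrite absz_gt0.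
set W := (3 * x ^+ 2 + A * z ^+ 4) ^+ 2 - 8 * x * y ^+ 2.
have oW : ~~ (2 %| W)%Z.
  rewrite /W rpredDr; last by rewrite rpredN -mulrA dvdz_mulr.
  rewrite dvdz2X andbT rpredDr; last by rewrite dvdz_mull // dvdz2X dz.
  by rewrite dvdz2M dvdz2X (negPf ox).
have nW : W != 0 by apply: contra oW => /eqP ->.
have ny : y != 0 by apply: contra oy => /eqP ->.
have {}r : z' ^+ 2 * W = 4 * y ^+ 2 * z ^+ 2 * x'.
  rewrite /W mulrBr -r; ring.
have nx' : x' != 0.
  apply/eqP => x0; move/eqP: r; rewrite x0 mulr0 mulf_eq0 (negPf nW) orbF.
  by rewrite expf_eq0 (negPf nz').
have : logn 2 `|z' ^+ 2 * W| = logn 2 `|4 * y ^+ 2 * z ^+ 2 * x'| by rewrite r.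
have ex (t : int) : (`|t ^+ 2| = `|t| * `|t|)%N by rewrite abszX expnS expn1.
rewrite !(ex, abszM) !lognM ?muln_gt0 ?absz_gt0 ?nz ?nz' ?ny ?nW ?nx' //.
rewrite (logn2_odd oW) (logn2_odd oy) (_ : logn 2 `|4%R : int| = 2%N) // => el.
have ex' : logn 2 `|x'| = 0%N.
  have dz' : (2 %| z')%Z.
    rewrite dvdzE; apply: contraT => /= nd.
    by move: el; rewrite (logn2_odd (x := z')) ?dvdzE.
  by case/andP: (reduced_form_odd h' dz') => o _; apply: logn2_odd.
move: el; rewrite ex'; clear; move: (logn _ _) (logn _ _) => i j; lia.
Qed.

(** As z' is odd, the duplication formula passes divisibility from 2y to the slope numerator 3x^2 +
    Az^4. The homogenised Bezout identity, times 4, then passes it to the discriminant. *)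
Lemma discriminant_dvd (Q : E) x y z x' y' z' N :
  Q +' Q <> ec0 _ _ -> reduced_form Q x y z -> reduced_form (Q +' Q) x' y' z' ->
  ~~ (2 %| z)%Z -> ~~ (2 %| z')%Z -> (2 ^+ N %| 2 * y)%Z ->
  (2 ^+ N %| 4 * (4 * A ^+ 3 + 27 * B ^+ 2))%Z.
Proof.
move=> n0 h h' oz oz' d2y.
have c := reduced_form_curve h; have r := reduced_form_double n0 h h'.
have dF : (2 ^+ N %| 3 * x ^+ 2 + A * z ^+ 4)%Z.
  rewrite -(Gauss_dvdzr _ (coprime_exp2 N oz')) -(dvdz_pexp2r _ _ (ltn0Sn 1)).
  by rewrite exprMn -r dvdz_mull // dvdz_exp2r.
have odd8 : ~~ (2 %| z ^+ 8)%Z by rewrite dvdz2X andbT.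
rewrite -(Gauss_dvdzl _ (coprime_exp2 N odd8)).
have -> : 4 * (4 * A ^+ 3 + 27 * B ^+ 2) * z ^+ 8 =
  (27 * B * z ^+ 2 - 18 * A * x) * (2 * y) ^+ 2 +
  4 * (6 * A * x ^+ 2 - 9 * B * x * z ^+ 2 + 4 * A ^+ 2 * z ^+ 4) *
    (3 * x ^+ 2 + A * z ^+ 4).
  by rewrite exprMn c; ring.
by apply: rpredD; apply: dvdz_mull => //; apply: dvdz_exp.
Qed.

(** Congruent coordinates make the denominator of the chord slope divisible by 2^N. As z is odd, its
    numerator y2 z1^3 + y1 z2^3 is divisible too, and this is congruent to 2 y2 z1^3. *)
Lemma difference_dvd (Q R : E) x y z x1 y1 z1 x2 y2 z2 N :
  R <> ec0 _ _ -> R +' Q +' Q <> ec0 _ _ ->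
  reduced_form Q x1 y1 z1 -> reduced_form (R +' Q) x2 y2 z2 ->
  reduced_form R x y z ->
  ~~ (2 %| z)%Z -> ~~ (2 %| z1)%Z ->
  (2 ^+ N %| x1 - x2)%Z -> (2 ^+ N %| y1 - y2)%Z -> (2 ^+ N %| z1 - z2)%Z ->
  (2 ^+ N %| 2 * y2)%Z.
Proof.
move=> n1 n2 h1 h2 h oz oz1 dx dy dz; have r := reduced_form_diff n1 n2 h1 h2 h.
have dU : (2 ^+ N %| x2 * z1 ^+ 2 - x1 * z2 ^+ 2)%Z.
  have -> : x2 * z1 ^+ 2 - x1 * z2 ^+ 2 =
    x2 * (z1 + z2) * (z1 - z2) - z2 ^+ 2 * (x1 - x2) by ring.
  by rewrite rpredB // dvdz_mull.
have dV : (2 ^+ N %| y2 * z1 ^+ 3 + y1 * z2 ^+ 3)%Z.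
  rewrite -(Gauss_dvdzr _ (coprime_exp2 N oz)) -(dvdz_pexp2r _ _ (ltn0Sn 1)).
  by rewrite exprMn -r dvdz_mull // dvdz_exp2r.
have odd3 : ~~ (2 %| z1 ^+ 3)%Z by rewrite dvdz2X andbT.
rewrite -(Gauss_dvdzl _ (coprime_exp2 N odd3)).
have -> : 2 * y2 * z1 ^+ 3 = y2 * z1 ^+ 3 + y1 * z2 ^+ 3
  + (y2 * (z1 ^+ 2 + z1 * z2 + z2 ^+ 2) * (z1 - z2) - z2 ^+ 3 * (y1 - y2)) by ring.
by rewrite rpredD // rpredB // dvdz_mull.
Qed.

(** * Valuations of the denominators of the multiples of P *)

Variables (P : E) (z : nat -> int).
Hypothesis P_inf : infinite_order P.
Hypothesis z_denom : forall n, (0 < n)%N ->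
  exists x y, reduced_form (ec_mul n P) x y (z n).

Lemma ec_mul_double n : ec_mul (n + n) P = ec_mul n P +' ec_mul n P.
Proof. exact: (ec_mulD char2_rat disc_rat). Qed.

Lemma exists_even_denominator : exists r, (0 < r)%N /\ (2 %| z r)%Z.
Proof.
(* The modulus 2^(|D|+1) exceeds |D|, so it cannot divide the nonzero integer D. *)
set D := 4 * (4 * A ^+ 3 + 27 * B ^+ 2).
have [M eM] : exists M, (2 ^ `|D|.+1 = M.+1)%N.
  by exists (2 ^ `|D|.+1).-1; rewrite prednK ?expn_gt0.
pose p n (t : 'I_M.+1 * 'I_M.+1 * 'I_M.+1) := exists x y,
  reduced_form (ec_mul n P) x y (z n) /\ t = (residue M x, residue M y, residue M (z n)).
have [n n0|m [n [t [m0 mn [x1 [y1 [h1 ->]]] [x2 [y2 [h2 [ex ey ez]]]]]]]] := @pigeonhole _ p 1.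
  by have [x [y h]] := z_denom n0; exists (residue M x, residue M y, residue M (z n)), x, y.
have eM' : M.+1%:Z = 2 ^+ `|D|.+1 by rewrite -eM -natz natrX.
move: ex ey ez => /residue_dvd; rewrite eM' => dx /residue_dvd; rewrite eM' => dy.
move=> /residue_dvd; rewrite eM' => dz.
have n0 : (0 < n)%N by apply: ltn_trans mn.
have d0 : (0 < n - m)%N by rewrite subn_gt0.
have nn0 : (0 < n + n)%N by rewrite addn_gt0 n0.
(* If the denominators at m, n, n - m and 2n were all odd, the modulus would divide D. *)
have [o1|o1] := boolP (2 %| z m)%Z; first by exists m.
have [o2|o2] := boolP (2 %| z n)%Z; first by exists n.
have [o3|o3] := boolP (2 %| z (n - m)%N)%Z; first by exists (n - m)%N.
have [o4|o4] := boolP (2 %| z (n + n)%N)%Z; first by exists (n + n)%N.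
have [x [y h]] := z_denom d0; have [x' [y' h']] := z_denom nn0.
have eRQ : ec_mul (n - m) P +' ec_mul m P = ec_mul n P.
  by rewrite -(ec_mulD char2_rat disc_rat) subnK // ltnW.
have dyn : (2 ^+ `|D|.+1 %| 2 * y2)%Z.
  apply: (difference_dvd _ _ h1 _ h o3 o1 dx dy dz).
  - exact: P_inf.
  - by rewrite eRQ -(ec_mulD char2_rat disc_rat); apply: P_inf; rewrite addn_gt0 n0.
  - by rewrite eRQ.
have := ec_mul_double n => e2; rewrite e2 in h'.
have := discriminant_dvd _ h2 h' o2 o4 dyn.
rewrite -e2 => /(_ (P_inf nn0)); rewrite -/D dvdzE abszX => /dvdn_leq.
rewrite absz_gt0 /D mulf_neq0 // => /(_ isT).
by rewrite leqNgt (leq_trans (ltn_expl _ (ltnSn 1))) // leq_exp2l.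
Qed.

Lemma logn_denominator_double n : (0 < n)%N -> (2 %| z n)%Z ->
  logn 2 `|z (n + n)%N| = (logn 2 `|z n|).+1.
Proof.
move=> n0 dz; have nn0 : (0 < n + n)%N by rewrite addn_gt0 n0.
have [x [y h]] := z_denom n0; have [x' [y' h']] := z_denom nn0.
have e2 := ec_mul_double n; have := P_inf nn0; rewrite e2 in h' *.
by move=> n2; apply: reduced_form_logn_double n2 h h' dz.
Qed.

Lemma denominator_neq0 n : (0 < n)%N -> z n != 0.
Proof. by move=> /z_denom[x [y []]]. Qed.

Lemma logn_denominator_pow2 r k : (0 < r)%N -> (2 %| z r)%Z ->
  logn 2 `|z (r * 2 ^ k)%N| = (logn 2 `|z r| + k)%N.
Proof.
move=> r0 dz; elim: k => [|k IH]; first by rewrite muln1 addn0.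
rewrite expnS mulnCA mul2n -addnn logn_denominator_double ?IH ?addnS //.
  by rewrite muln_gt0 r0 expn_gt0.
have zr : z r != 0 := denominator_neq0 r0.
have zk : z (r * 2 ^ k)%N != 0 by rewrite denominator_neq0 // muln_gt0 r0 expn_gt0.
move: dz; rewrite !dvdzE -[`|2|%N]/(2 ^ 1)%N !pfactor_dvdn ?absz_gt0 // IH.
by move=> l; rewrite (leq_trans l) // leq_addr.
Qed.

End Denominators.

(** * Linear recurrences modulo powers of 2 *)

Section Recurrence.
Variable u : nat -> int.

(* A polynomial p in the shift operator annihilates (u_n)_{n >= 1} exactly when
   [shift_form (q * p) = 0] for all q. *)
Definition shift_form (p : {poly int}) : int := \sum_(i < size p) p`_i * u i.+1.

Lemma shift_form_widen n (p : {poly int}) : (size p <= n)%N ->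
  shift_form p = \sum_(i < n) p`_i * u i.+1.
Proof.
move=> le; rewrite /shift_form (big_ord_widen n (fun i => p`_i * u i.+1) le).
rewrite big_mkcond; apply: eq_bigr => i _; case: ltnP => // h.
by rewrite nth_default // mul0r.
Qed.

Lemma shift_form_linear : scalar shift_form.
Proof.
move=> c p q; set n := maxn (size p) (size q).
have lp : (size p <= n)%N by rewrite leq_maxl.
have lq : (size q <= n)%N by rewrite leq_maxr.
rewrite (shift_form_widen lp) (shift_form_widen lq) (@shift_form_widen n); last first.
  rewrite (leq_trans (size_polyD _ _)) // geq_max lq andbT.
  exact: leq_trans (size_scale_leq _ _) lp.
rewrite mulr_sumr -big_split /=; apply: eq_bigr => i _.
by rewrite coefD coefZ mulrDl mulrA.
Qed.

HB.instance Definition _ := GRing.isLinear.Build int {poly int} int *%R shift_form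
  shift_form_linear.

Lemma shift_formZ c p : shift_form (c *: p) = c * shift_form p.
Proof. exact: (scalarZ shift_form). Qed.

Lemma shift_formXn i : shift_form 'X^i = u i.+1.
Proof.
rewrite (@shift_form_widen i.+1) ?size_polyXn // big_ord_recr /= coefXn eqxx mul1r.
rewrite big1 ?add0r // => j _; rewrite coefXn.
by rewrite (ltn_eqF (ltn_ord j)) mul0r.
Qed.

Lemma shift_form_annihilator (p : {poly int}) :
  (forall t, shift_form ('X^t * p) = 0) -> forall q, shift_form (q * p) = 0.
Proof.
move=> h q; rewrite -(coefK q) poly_def mulr_suml raddf_sum big1 // => i _.
by rewrite -scalerAl /= shift_formZ h mulr0.
Qed.

Lemma shift_form_pow2 (m T : nat) (b : {poly int}) :
  (forall q, shift_form (q * ('X^m * ('X^T - 1) - 2 *: b)) = 0) ->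
  forall j, exists c, forall q,
    shift_form (q * ('X^(m * 2 ^ j) * ('X^(T * 2 ^ j) - 1) - 2 ^+ j.+1 *: c)) = 0.
Proof.
move=> h; elim=> [|j [c IH]]; first by exists b => q; rewrite !muln1 expr1.
set X := 'X^(m * 2 ^ j) in IH; set Y := 'X^(T * 2 ^ j) in IH.
(* Modulo the relation X(Y - 1) = 2^(j+1) c, one has X^2(Y^2 - 1) = X(Y - 1)(X(Y - 1) + 2X) =
   2^(j+2) c (2^j c + X). *)
exists (c * (2 ^+ j *: c + X)) => q.
have -> : 'X^(m * 2 ^ j.+1) = X ^+ 2 by rewrite -exprM -mulnA expnSr.
have -> : 'X^(T * 2 ^ j.+1) = Y ^+ 2 by rewrite -exprM -mulnA expnSr.
rewrite -[RHS](IH (q * (X * (Y - 1) + 2 *: X + 2 ^+ j.+1 *: c))); congr shift_form.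
rewrite !exprS -!mul_polyC !polyCM; ring.
Qed.

Lemma shift_form_period (m T : nat) (b : {poly int}) :
  (forall q, shift_form (q * ('X^m * ('X^T - 1) - 2 *: b)) = 0) ->
  forall j n l, (m * 2 ^ j <= n)%N ->
    (2 ^+ j.+1 %| u (n + T * 2 ^ j * l).+1 - u n.+1)%Z.
Proof.
move=> /shift_form_pow2 h j n l le; have [c {}h] := h j.
elim: l => [|l IH]; first by rewrite muln0 addn0 subrr dvdz0.
set N := (n + _ * l)%N in IH.
have leN : (m * 2 ^ j <= N)%N by rewrite (leq_trans le) // leq_addr.
have -> : (n + T * 2 ^ j * l.+1 = N + T * 2 ^ j)%N by rewrite mulnS addnCA addnC.
rewrite -(subrK (u N.+1) (u _)) -addrA; apply: rpredD => //.
have := h 'X^(N - m * 2 ^ j).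
rewrite mulrBr mulrA -exprD subnK // mulrBr mulr1 -exprD -scalerAr !raddfB /=.
rewrite !shift_formXn shift_formZ => /eqP; rewrite subr_eq0 => /eqP ->.
by rewrite dvdz_mulr.
Qed.


Lemma shift_formXM t (p : {poly int}) :
  shift_form ('X^t * p) = \sum_(l < size p) p`_l * u (t + l).+1.
Proof.
rewrite -{1}(coefK p) poly_def mulr_sumr raddf_sum; apply: eq_bigr => l _ /=.
by rewrite -scalerAr shift_formZ -exprD shift_formXn.
Qed.

(** * An annihilator of the form X^m (X^T - 1) - 2b *)

Variables (K : numFieldType) (c : nat -> K) (k : nat).
Hypothesis u_rec : forall n, (0 < n)%N ->
  (u (n + k)%N)%:~R = \sum_(i < k) c i * (u (n + k - i.+1)%N)%:~R.

Lemma shift_form_rec t (p : {poly int}) :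
  (shift_form ('X^(t + k) * p))%:~R =
  \sum_(i < k) c i * (shift_form ('X^(t + k - i.+1) * p))%:~R.
Proof.
rewrite shift_formXM rmorph_sum /=.
under [RHS]eq_bigr => i _ do rewrite shift_formXM rmorph_sum mulr_sumr.
rewrite exchange_big /=; apply: eq_bigr => l _.
have -> : (t + k + l).+1 = ((t + l).+1 + k)%N by rewrite addSn addnAC.
rewrite rmorphM /= u_rec // mulr_sumr; apply: eq_bigr => i _.
rewrite rmorphM /= mulrCA; congr (_ * (_ * (u _)%:~R)).
by have := ltn_ord i; lia.
Qed.

(** The values at X^t p satisfy the recurrence of u in t, so k initial zeros propagate. *)
Lemma shift_form_eq0 (p : {poly int}) :
  (forall t, (t < k)%N -> shift_form ('X^t * p) = 0) ->
  forall q, shift_form (q * p) = 0.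
Proof.
move=> h; apply: shift_form_annihilator; elim/ltn_ind => t IH.
have [/h //|le] := ltnP t k; apply: (@intr_inj K).
rewrite -(subnK le) shift_form_rec big1 // => i _; rewrite IH ?mulr0 //.
by have := ltn_ord i; lia.
Qed.

Definition window n : 'rV[int]_k := \row_(i < k) u (n + i).+1.
(** The k by k Hankel matrix of u. *)
Definition windows : 'M[int]_k := \matrix_(j < k) window j.

(** The recurrence proves the inclusion over K by strong induction. Row space inclusion of rational
    matrices is unchanged by field extension, so it descends to the rationals, where denominators
    can be cleared. *)
Lemma window_span n :
  ((map_mx intr (window n) : 'rV[rat]_k) <= (map_mx intr windows : 'M[rat]_k))%MS.
Proof.
rewrite -(map_submx (@ratr K)) -!map_mx_comp.
have e : (ratr \o intr : int -> K) =1 intr by move=> x /=; rewrite ratr_int.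
rewrite !(eq_map_mx _ e); elim/ltn_ind: n => n IH.
have [lt|le] := ltnP n k.
  have -> : window n = row (Ordinal lt) windows by rewrite rowK.
  by rewrite map_row row_sub.
have -> : map_mx intr (window n) =
    \sum_(i < k) c i *: map_mx intr (window (n - i.+1)) :> 'rV[K]_k.
  apply/rowP => j; rewrite !mxE summxE.
  have -> : (n + j).+1 = ((n - k + j).+1 + k)%N by rewrite addSn addnAC subnK.
  rewrite u_rec //; apply: eq_bigr => i _; rewrite !mxE; congr (_ * (u _)%:~R).
  by have := ltn_ord i; lia.
apply: summx_sub => i _; apply: scalemx_sub; apply: IH.
by have := ltn_ord i; lia.
Qed.

Lemma common_denominator (I : finType) (f : I -> rat) :
  exists2 D : int, D != 0 & exists a : I -> int, forall i, D%:~R * f i = (a i)%:~R.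
Proof.
exists (\prod_i denq (f i)); first by apply/prodf_neq0 => i _; apply: denq_neq0.
exists (fun i => numq (f i) * \prod_(j | j != i) denq (f j)) => i.
rewrite (bigD1 i) //= !rmorphM /= mulrAC [_ * f i]mulrC; congr (_ * _).
by rewrite -{1}[f i]divq_num_den divfK // intr_eq0 denq_neq0.
Qed.

(* Two windows that agree modulo twice a common denominator of [pinvmx windows]
   differ by twice an integral combination of the first k windows. *)
Lemma exists_even_annihilator :
  exists m T (b : {poly int}), (0 < T)%N /\
    forall q, shift_form (q * ('X^m * ('X^T - 1) - 2 *: b)) = 0.
Proof.
set W : 'M[rat]_k := map_mx intr windows.
have [D nD [a ha]] := common_denominator (fun ij => pinvmx W ij.1 ij.2).
pose M := `|(2 * D)%R|%N.-1.
have eM : M.+1 = `|(2 * D)%R|%N by rewrite prednK // absz_gt0 mulf_neq0.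
pose p n (t : {ffun 'I_k -> 'I_M.+1}) :=
    forall i : 'I_k, residue M (u (n + i).+1) = t i.
have [n _|m [n [t [_ lt h1 h2]]]] := @pigeonhole _ p 0.
  by exists [ffun i : 'I_k => residue M (u (n + i).+1)] => i; rewrite ffunE.
have dvd (i : 'I_k) : (2 * D %| u (n + i).+1 - u (m + i).+1)%Z.
  by rewrite dvdzE -eM -[M.+1]/(absz M.+1%:Z) -dvdzE; apply: residue_dvd; rewrite h1 h2.
pose w : 'rV[int]_k := \row_i ((u (n + i).+1 - u (m + i).+1) %/ (2 * D))%Z.
have ew : window n - window m = (2 * D) *: w.
  by apply/rowP => i; rewrite !mxE mulrC divzK.
pose Z : 'M[int]_k := \matrix_(i, j) a (i, j).
have eZ : map_mx intr Z = D%:~R *: pinvmx W 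
  by apply/matrixP => i j; rewrite [LHS]mxE [RHS]mxE [Z i j]mxE -ha.
have eb : window n - window m = 2 *: (w *m Z *m windows).
  suff e : map_mx intr (window n - window m) =
           map_mx intr (2 *: (w *m Z *m windows)) :> 'rV[rat]_k.
    apply/rowP => i; apply: (@intr_inj rat).
    by have /rowP/(_ i) := e; rewrite [LHS]mxE [RHS]mxE.
  rewrite map_mxZ !map_mxM -/W eZ /=.
  (* A vector v in the row space of W equals v [pinvmx W] W; here v = 2D w, and D [pinvmx W] is the
     integral matrix Z. *)
  rewrite -[LHS](mulmxKpV (B := W)).
    by rewrite ew map_mxZ rmorphM /= -!scalemxAl -scalemxAr -!scalemxAl scalerA.
  by rewrite map_mxB addmx_sub ?eqmx_opp ?window_span.
exists m, (n - m)%N, (\sum_(j < k) (w *m Z) 0 j *: 'X^j); rewrite subn_gt0 lt; split=> //.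
apply: shift_form_eq0 => s ls.
have := congr1 (fun v : 'rV_k => v 0 (Ordinal ls)) eb; rewrite !mxE /= => e.
rewrite mulrBr mulrBr mulr1 mulrBr -!exprD subnKC ?(ltnW lt) // -scalerAr.
rewrite !raddfB /= shift_formZ !shift_formXn addnC [(s + m)%N]addnC e.
apply/eqP; rewrite subr_eq0; apply/eqP; congr (_ * _).
rewrite mulr_sumr raddf_sum; apply: eq_bigr => j _ /=.
by rewrite -scalerAr shift_formZ -exprD shift_formXn !mxE addnC.
Qed.

End Recurrence.

(** * Comparison of the two valuations *)

(** Euler's theorem; the free factor [f] makes the exponent arbitrarily large. *)
Lemma odd_dvd_exp4_sub1 T f : coprime 2 T -> (T %| 4 ^ (totient T * f) - 1)%N.
Proof.
move=> co; rewrite -eqn_mod_dvd ?expn_gt0 // expnM -modnXm Euler_exp_totient.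
  by rewrite modnXm exp1n.
by rewrite -[4%N]/(2 ^ 2)%N coprimeXl.
Qed.

Theorem theorem1 (K : numFieldType) (A B : int)
    (hAB : 4 * A ^+ 3 + 27 * B ^+ 2 != 0)
    (P : ec (A%:~R : rat) (B%:~R : rat)) (hP : infinite_order P)
    (z : nat -> int)
    (hz : forall n : nat, (0 < n)%N ->
       exists x y : int,
         [/\ z n != 0,
             gcdz (gcdz x y) (z n) = 1 &
             val (ec_mul n P) =
               Some ((x%:~R : rat) / (z n)%:~R ^+ 2,
                     (y%:~R : rat) / (z n)%:~R ^+ 3)]) :
  ~ exists u : nat -> int,
      lin_rec_seq K u /\
      exists N : nat, forall n : nat,
        (0 < n)%N -> (N <= n)%N -> z n = u (n ^ 2)%N.
Proof.
case=> u [[k [_ [c [_ u_rec]] _]] [N zu]].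
have [m [T [b [T0 ann]]]] := exists_even_annihilator u_rec.
have [r [r0 zr]] := exists_even_denominator hAB hP hz.
have logz s := logn_denominator_pow2 hAB hP hz s r0 zr.
have [T' co eT] := pfactor_coprime (isT : prime 2) T0.
set e := logn 2 T in eT; set v := logn 2 `|z r| in logz.
have T'0 : (0 < T')%N by rewrite lt0n; apply: contraTneq T0 => T'0; rewrite eT T'0.
(* Chosen so that 4^s = 2^j 2^e 2^m with j at least v + s, and so that r 2^s is at least N. *)
pose s := (v + e + m + N)%N; pose j := (2 * s - e - m)%N.
have es : (2 * s = j + e + m)%N by rewrite /j /s; lia.
have vs : (v + s <= j)%N by rewrite /j /s; lia.
have r2 : (0 < r ^ 2)%N by rewrite expn_gt0 r0.
pose f := (totient T' * j.+1)%N.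
have lf : (j < f)%N by rewrite /f leq_pmull // totient_gt0.
have /dvdnP[q eq] : (T' %| 4 ^ f - 1)%N by apply: odd_dvd_exp4_sub1.
have n0 i : (0 < r * 2 ^ i)%N by rewrite muln_gt0 r0 expn_gt0.
have zE i : (s <= i)%N -> z (r * 2 ^ i)%N = u (r ^ 2 * 4 ^ i)%N.
  move=> le; rewrite zu ?n0 //; first by rewrite expnMn -expnM [(i * 2)%N]mulnC expnM.
  rewrite (leq_trans _ (leq_pmull _ r0)) // ltnW // (leq_trans _ (ltn_expl i (ltnSn 1))) //.
  by rewrite ltnS (leq_trans _ le) // /s leq_addl.
have dvdE i n : (2 ^+ i %| z (r * 2 ^ n)%N)%Z = (i <= v + n)%N.
  by rewrite dvdzE abszX pfactor_dvdn ?absz_gt0 ?(denominator_neq0 hz) // logz.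
have e4 : (4 ^ s = 2 ^ j * 2 ^ e * 2 ^ m)%N by rewrite -!expnD -es expnM.
(* The predecessor, because periodicity is stated for [u n.+1]. *)
pose n := (r ^ 2 * 4 ^ s).-1.
have en : (n.+1 = r ^ 2 * 4 ^ s)%N by rewrite prednK // muln_gt0 r2 expn_gt0.
have le : (m * 2 ^ j <= n)%N.
  rewrite -ltnS en (leq_trans _ (leq_pmull _ r2)) // e4 -mulnA mulnC ltn_pmul2l ?expn_gt0 //.
  by rewrite (leq_trans (ltn_expl m (ltnSn 1))) // leq_pmull // expn_gt0.
(* The number of periods: r^2 4^s (4^f - 1) = r^2 2^j 2^e 2^m q T' = (T 2^j)(2^m r^2 q). *)
have /(_ (2 ^ m * r ^ 2 * q)%N) := shift_form_period ann _ le.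
have -> : (n + T * 2 ^ j * (2 ^ m * r ^ 2 * q)).+1 = (r ^ 2 * 4 ^ (s + f))%N.
  rewrite -addSn en expnD [in RHS](_ : 4 ^ f = 1 + q * T')%N; last first.
    by rewrite -eq subnKC // expn_gt0.
  by rewrite eT e4; ring.
rewrite en -!zE ?leq_addr // => d.
(* Since f > j, the later term is divisible by 2^(j+1), hence so is the earlier one, whose valuation
   v + s is at most j. *)
have d' : (2 ^+ j.+1 %| z (r * 2 ^ (s + f))%N)%Z.
  by rewrite dvdE (leq_trans lf) // addnA leq_addl.
have : (2 ^+ j.+1 %| z (r * 2 ^ s)%N)%Z.
  by rewrite -(subKr (z (r * 2 ^ (s + f))%N) (z _)) rpredB.
by rewrite dvdE ltnNge vs.
Qed.
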